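(* The set of uniformly recurrent words generated by piecewise continuous transformations of the interval coincides with the set of uniformly recurrent words generated by interval exchange transformations.
   Context: An infinite word $W$ over a finite alphabet is uniformly recurrent if for every finite subword $v$ of $W$ there is $N(v)$ such that $v$ is a subword of every subword of $W$ of length at least $N(v)$. A piecewise continuous transformation of the interval $I=[0,1]$ is a map $T:I\to I$ of the following form: $I=[x_0,x_1]\cup\dots\cup[x_{n-1},x_n]$ with $x_0=0$, $x_n=1$; $I=[y_0,y_1]\cup\dots\cup[y_{n-1},y_n]$ with $y_0=0$, $y_n=1$; $\sigma$ is a permutation of the $n$ indices; and $T$ maps $(x_i,x_{i+1})$ onto $(y_{\sigma(i)},y_{\sigma(i)+1})$ continuously and bijectively. An interval exchange transformation is such a $T$ that maps each interval isometrically (by a translation or, for flipped intervals, by a translation composed with reflection about the midpoint). $W=(w_n)$ over $A=\{a_1,\dots,a_s\}$ is generated by $T$ if there are characteristic sets $U_1,\dots,U_s$ partitioning $[0,1]$, each a finite union of disjoint intervals (open, closed or half-open), and a point $x$ such that $W$ is the evolution of $x$: $w_n=a_i$ when $T^{n}(x)\in U_i$. If the trajectory hits boundaries, evolution is understood as essential evolution: a finite word $v$ is an essential finite evolution of $x^*$ if every neighbourhood of $x^*$ contains a nonempty open set all of whose points have evolution $v$; an infinite word is an essential evolution if all its initial finite subwords are essential finite evolutions. *)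

(* Defs.v *)
From HB Require Import structures.
From mathcomp Require Import all_boot all_order all_algebra all_fingroup.
From mathcomp Require Import all_classical all_reals all_analysis.

Set Implicit Arguments.
Unset Strict Implicit.
Unset Printing Implicit Defensive.

Import Order.TTheory GRing.Theory Num.Theory.
Import numFieldNormedType.Exports.

Local Open Scope classical_set_scope.
Local Open Scope ring_scope.

Section Words.
Context {A : finType}.
Implicit Types (v u : seq A) (W : nat -> A).

Definition subword v W : Prop :=
  exists k, v = mkseq (fun i => W (k + i)%N) (size v).

Definition uniformly_recurrent W : Prop :=
  forall v, subword v W ->
  exists N, forall u, subword u W -> (N <= size u)%N -> infix v u.

End Words.

(* The values of [d] beyond index [n] are irrelevant. *)
Definition subdivision {R : realType} (n : nat) (d : nat -> R) : Prop :=
  [/\ d 0 = 0, d n = 1 & forall i, (i < n)%N -> d i < d i.+1].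

(* A map of [0, 1] is encoded as a total function on R whose values outside
   [0, 1] are irrelevant.  Its values at the division points are arbitrary
   points of [0, 1]. *)
Record pct (R : realType) := PCT {
  pieces : nat;
  src : nat -> R;
  dst : nat -> R;
  shuffle : 'S_pieces;
  pct_map :> R -> R;
  src_subdivision : subdivision pieces src;
  dst_subdivision : subdivision pieces dst;
  pct_stable : set_fun `[0, 1]%classic `[0, 1]%classic pct_map;
  pct_continuous : forall i : 'I_pieces,
    {in `]src i, src i.+1[, continuous pct_map};
  pct_bij : forall i : 'I_pieces,
    set_bij `]src i, src i.+1[%classic
            `]dst (shuffle i), dst (shuffle i).+1[%classic pct_map }.

Section Transformations.
Context {R : realType}.
Implicit Types T : pct R.

(* On each piece: a translation, or the reflection about the midpoint of the
   piece followed by a translation. *)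
Definition is_iet T : Prop :=
  forall i : 'I_(pieces T), exists c : R,
    {in `]src T i, src T i.+1[, forall t, T t = t + c} \/
    {in `]src T i, src T i.+1[, forall t,
       T t = (src T i + src T i.+1 - t) + c}.

(* Unbounded elements of [interval R] are excluded wherever this is applied to
   a subset of [0, 1]. *)
Definition finite_union_of_intervals (B : set R) : Prop :=
  exists s : seq (interval R),
    trivIset [set` s] (fun J => [set` J]) /\
    B = \bigcup_(J in [set` s]) [set` J].

Context {A : finType}.
Implicit Types (U : A -> set R) (W : nat -> A) (v : seq A) (x : R).

Definition characteristic_sets U : Prop :=
  [/\ \bigcup_a U a = `[0, 1]%classic,
      trivIset [set: A] U &
      forall a, finite_union_of_intervals (U a)].

Definition finite_evolution T U x v : Prop :=
  forall k a, onth v k = Some a -> U a (iter k T x).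

Definition evolution T U x W : Prop :=
  forall k, U (W k) (iter k T x).

(* Neighbourhoods and open sets are those of the subspace [0, 1]: they are
   represented by their traces on [0, 1]. *)
Definition essential_finite_evolution T U x v : Prop :=
  forall B : set R, nbhs x B ->
  exists V : set R,
    [/\ open V, V `&` `[0, 1] !=set0, V `&` `[0, 1] `<=` B &
        forall y, (V `&` `[0, 1]) y -> finite_evolution T U y v].

Definition essential_evolution T U x W : Prop :=
  forall n, essential_finite_evolution T U x (mkseq W n).

Definition hits_boundary T U x : Prop :=
  exists k,
    (exists2 i, (i <= pieces T)%N & iter k T x = src T i) \/
    (exists a, (closure (U a) `\` interior (U a)) (iter k T x)).

Definition generated_by T W : Prop :=
  exists (U : A -> set R) (x : R),
    [/\ characteristic_sets U, x \in `[0, 1],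
        (~ hits_boundary T U x -> evolution T U x W) &
        (hits_boundary T U x -> essential_evolution T U x W)].

End Transformations.

(* Main.v *)
Require Import Defs.
From mathcomp Require Import all_boot all_order all_algebra all_fingroup.
From mathcomp Require Import all_classical all_reals all_analysis.
From mathcomp Require Import zify ring lra.

Set Implicit Arguments.
Unset Strict Implicit.
Unset Printing Implicit Defensive.

Import Order.TTheory GRing.Theory Num.Theory.
Import numFieldNormedType.Exports.

Local Open Scope classical_set_scope.

(** A word [W] is generated by [T] exactly when, for suitable characteristic
    sets, every prefix of [W] is the evolution of all the points of some
    nonempty open subset of [[0, 1]]: such open sets can be chosen around points
    that accumulate somewhere, by compactness, and an accumulation point is a
    base point for [W] ([generated_realizes], [realizes_generated]).  The base
    point thus disappears from the problem.

    One inclusion is trivial.  For the other, let [W] be uniformly recurrent and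
    generated by [T].  If [W] has a period [p], it codes an orbit of the
    rotation by [1 / p] ([periodic_iet]).  Otherwise the idea is to straighten
    [T] by a change of variable that turns an invariant measure into length.

    Pick points [y N] whose first [N + 1] letters are those of [W], and average
    functions over the corresponding finite orbits; the limits of the averages
    along an ultrafilter form a [T]-invariant mean ([orbit_mean_exists]), hence
    a finitely additive invariant [density] on all the subsets of [[0, 1]].
    Because [W] is uniformly recurrent and aperiodic, its long factors only
    return after a long time ([repetitions_far_apart]), so that a set of points
    with a common long code has small density ([density_cell]).  Since finitely
    many points cut [[0, 1]] into cells with a common code
    ([code_locally_constant]), the function [phi] that gives the density of
    the points below its argument ([cumul]) is continuous, and maps [[0, 1]] onto itself.

    As [T] is monotone on its pieces and preserves the density, [phi] carries
    [T] to a map that is a translation or a reflection on the image of each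
    piece ([cumul_piece]).  A piece of density zero is collapsed to a point; it
    can be removed from the exchange ([weak_exchange_iet]).  Finally, the points
    whose evolution starts with a given prefix of [W] have positive density, by
    uniform recurrence, whereas the points whose orbit has an image under [phi]
    in a given finite set have density zero.  So some point has the right
    evolution and an orbit whose image avoids all the discontinuities; its
    image, and then a neighbourhood of it, has the same evolution in the
    exchange ([aperiodic_iet]). *)

(** * Uniformly recurrent words *)

Section UniformRecurrence.
Context {A : finType}.
Implicit Types (W : nat -> A) (k l n p : nat).

Lemma factor_subword W k l : subword (mkseq (fun i => W (k + i)) l) W.
Proof. by exists k; rewrite size_mkseq. Qed.

Lemma infix_factor W k N m n :
  infix (mkseq (fun i => W (m + i)) n) (mkseq (fun i => W (k + i)) N) ->
  exists2 j, j + n <= N & forall i, i < n -> W (k + (j + i)) = W (m + i).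
Proof.
move=> /infixP[s1 [s2 E]].
have := congr1 size E; rewrite !size_cat !size_mkseq => sz.
exists (size s1) => [|i ltin]; first by rewrite sz leq_add2l leq_addr.
have := congr1 (nth (W 0) ^~ (size s1 + i)) E.
rewrite /= nth_mkseq; last by rewrite sz ltn_add2l ltn_addr.
by rewrite nth_cat ltnNge leq_addr /= addKn nth_cat size_mkseq ltin nth_mkseq.
Qed.

Lemma uniformly_recurrentP W : uniformly_recurrent W -> forall m n,
  exists N, forall k, exists2 j, j + n <= N &
    forall i, i < n -> W (k + (j + i)) = W (m + i).
Proof.
move=> ur m n; have [N HN] := ur _ (factor_subword W m n).
exists N => k; apply: infix_factor; apply: HN; first exact: factor_subword.
by rewrite size_mkseq.
Qed.

(** Passing from a period [j] of a factor to a multiple [p] makes the period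
    common to all the factors whose period is bounded: [p] will be a
    factorial. *)
Lemma locally_periodic_dvd W k l j p : 0 < j -> j %| p ->
  (forall i, i < l -> W (k + i) = W (k + j + i)) ->
  forall i, i + p <= l -> W (k + i) = W (k + i + p).
Proof.
move=> j0 /dvdnP[q ->] per; elim: q => [|q IH] i; first by rewrite !addn0.
rewrite mulSn => lil; rewrite IH; last by lia.
rewrite -addnA per; last by lia.
by congr W; lia.
Qed.

(** If arbitrarily long factors returned at a distance below [G], then
    arbitrarily long factors would have the period [G`!]; by uniform recurrence
    every factor of [W] occurs in one of them, so [W] itself would have that
    period. *)
Lemma repetitions_far_apart W : uniformly_recurrent W ->
  (forall p, 0 < p -> exists k, W (k + p) <> W k) ->
  forall G, exists l, forall k j, 0 < j < G ->
    ~ (forall i, i < l -> W (k + i) = W (k + j + i)).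
Proof.
move=> ur aper G; apply: contrapT => /forallNP close.
have [i0] := aper _ (fact_gt0 G); apply.
have [N HN] := uniformly_recurrentP ur i0 (G`!).+1.
have /existsNP[k /existsNP[j /not_implyP[/andP[j0 jG] /contrapT per]]] :=
  close (N + G`!).
have [s sN at_i0] := HN k.
rewrite -(at_i0 G`!) // -[i0 in RHS]addn0 -(at_i0 0) //.
rewrite addn0 addnA -(locally_periodic_dvd j0 _ per) //.
  by rewrite dvdn_fact // j0 ltnW.
by move: sN; clear; lia.
Qed.

End UniformRecurrence.

(** * Evolutions without base point *)

Section Realization.
Local Open Scope ring_scope.
Context {R : realType} {A : finType}.
Implicit Types (T : pct R) (U : A -> set R) (W : nat -> A) (x y t : R).

Definition realizes T U W := forall n, exists V : set R,
  [/\ open V, V `&` `[0, 1] !=set0 &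
      forall y, (V `&` `[0, 1]) y -> finite_evolution T U y (mkseq W n)].

Lemma onth_mkseq (f : nat -> A) n k :
  onth (mkseq f n) k = if (k < n)%N then Some (f k) else None.
Proof.
rewrite onthE /mkseq -map_comp; case: ltnP => [ltkn|nlek].
  by rewrite (nth_map 0%N) ?size_iota //= nth_iota.
by rewrite nth_default // size_map size_iota.
Qed.

Lemma finite_evolution_mkseq T U W y n :
  finite_evolution T U y (mkseq W n) <->
  forall k, (k < n)%N -> U (W k) (iter k T y).
Proof.
split=> [ev k ltkn|ev k a]; first by apply: ev; rewrite onth_mkseq ltkn.
by rewrite onth_mkseq; case: ltnP => // /ev ? [<-].
Qed.

Lemma gap_between (d : nat -> R) n t : d 0%N < t < d n ->
  (forall i, (i <= n)%N -> t <> d i) -> exists i : 'I_n, d i < t < d i.+1.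
Proof.
elim: n => [|n IH] /andP[d0t tdn] tNd.
  by have := lt_trans d0t tdn; rewrite ltxx.
have [tltdn|dnlet] := ltP t (d n).
  have [|i ilen|i Hi] := IH; first by rewrite d0t.
    by apply: tNd; rewrite leqW.
  by exists (widen_ord (leqnSn n) i).
exists ord_max; rewrite /= tdn andbT lt_neqAle dnlet andbT.
by apply/eqP => /esym/tNd; apply.
Qed.

Lemma subdivision_gap n (d : nat -> R) t : subdivision n d -> t \in `[0, 1] ->
  (forall i, (i <= n)%N -> t <> d i) -> exists i : 'I_n, t \in `]d i, d i.+1[.
Proof.
move=> [d0 dn _]; rewrite in_itv /= => /andP[t0 t1] tNd.
have [|i Hi] := gap_between _ tNd; last by exists i; rewrite in_itv.
rewrite d0 dn !lt_neqAle t0 t1 !andbT; apply/andP; split; apply/eqP => E.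
  by apply: (tNd 0%N); rewrite // d0.
by apply: (tNd n); rewrite // dn.
Qed.

Lemma iter_stable T k x : x \in `[0, 1] -> iter k T x \in `[0, 1].
Proof. by move=> x01; elim: k => //= k; exact: pct_stable. Qed.

Lemma iter_continuous T k x : x \in `[0, 1] ->
  (forall j i, (i <= pieces T)%N -> iter j T x <> src T i) ->
  {for x, continuous (iter k T)}.
Proof.
move=> x01 avoid; elim: k => [|k IH]; first exact: cvg_id.
have [i Hi] := subdivision_gap (src_subdivision T) (iter_stable T k x01) (avoid k).
exact: (continuous_comp IH (pct_continuous Hi)).
Qed.

(** The orbit of [x] stays inside the pieces of [T], where [T] is continuous,
    and in the interiors of the characteristic sets. *)
Lemma near_code T U x : x \in `[0, 1] ->
  ~ hits_boundary T U x -> forall k a, U a (iter k T x) ->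
  \forall y \near x, U a (iter k T y).
Proof.
move=> x01 /forallNP nohit k a Ua.
have avoid j i : (i <= pieces T)%N -> iter j T x <> src T i.
  by move=> ilen E; apply: (nohit j); left; exists i.
have cvgT : iter k T @ x --> iter k T x := iter_continuous x01 avoid.
apply: (cvgT (U a)).
apply: contrapT => Nint; apply: (nohit k); right; exists a; split => //.
exact: subset_closure.
Qed.

Lemma code_exists T U k x : characteristic_sets U -> x \in `[0, 1] ->
  exists a, U a (iter k T x).
Proof.
move=> [cov _ _] /(iter_stable T k) Hk.
have : `[0, 1]%classic (iter k T x) by [].
by rewrite -cov => -[a _ Ha]; exists a.
Qed.

Lemma code_unique U a b t : characteristic_sets U -> U a t -> U b t -> a = b.
Proof. by move=> [_ triv _] Ua Ub; apply: triv => //; exists t. Qed.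

Lemma generated_realizes T W : generated_by T W ->
  exists2 U, characteristic_sets U & realizes T U W.
Proof.
move=> [U [x [charU x01 ev ess]]]; exists U => // n.
have [/ess/(_ n setT)|/[dup] nohit /ev {}ev] := pselect (hits_boundary T U x).
  by move=> /(_ filterT) [V [oV V0 _ HV]]; exists V.
have : \forall y \near x, forall k, (k < n)%N -> U (W k) (iter k T y).
  elim: n => [|n IH]; first by apply: filterE => y k; rewrite ltn0.
  near=> y => k; rewrite ltnS leq_eqVlt => /predU1P[->|].
    by near: y; apply: near_code.
  by move: k; near: y.
rewrite -[X in X -> _]/(nbhs x _) nbhsE => -[V [oV Vx] HV].
exists V; split=> //; first by exists x.
by move=> y [/HV ? _]; apply/finite_evolution_mkseq.
Unshelve. all: by end_near. Qed.

(** The base point is a cluster point of points [t n] chosen in the open sets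
    that realize the prefixes of length [n].  When its orbit meets no boundary,
    its code is the one of the nearby points, hence [W]. *)
Lemma realizes_generated T U W : characteristic_sets U -> realizes T U W ->
  generated_by T W.
Proof.
move=> charU real.
have /choice[t Ht] : forall n, exists t, t \in `[0, 1] /\ exists V : set R,
   [/\ open V, V t & forall y, (V `&` `[0, 1]) y ->
      forall k, (k < n)%N -> U (W k) (iter k T y)].
  move=> n; have [V [oV [t [Vt t01]] HV]] := real n; exists t; split => //.
  by exists V; split=> // y /HV/finite_evolution_mkseq.
have [|x [x01 clx]] := @segment_compact R 0 1 (t @ \oo).
  by exists 0%N => // n _; case: (Ht n).
have ess : essential_evolution T U x W.
  move=> n B; rewrite nbhsE => -[B' [oB' B'x] B'B].
  have [||_ [[m /= nm <-] B'tm]] := clx (t @` [set m | (n <= m)%N]) B'.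
  - exists n => //= m /= nm; exists m => //.
  - by apply: open_nbhs_nbhs.
  have [t01 [V [oV Vt HV]]] := Ht m.
  exists (V `&` B'); split.
  - exact: openI.
  - by exists (t m).
  - by move=> y [[_ /B'B]].
  - move=> y [[Vy _] y01]; apply/finite_evolution_mkseq => k ltkn.
    by apply: HV => //; apply: leq_trans ltkn nm.
exists U, x; split => // nohit k.
have [a Ua] := code_exists T k charU x01.
have := near_code x01 nohit Ua.
move=> /(ess k.+1) [V [_ [y Vy] VB HV]].
have /finite_evolution_mkseq/(_ k (ltnSn k)) UW := HV _ Vy.
by rewrite (code_unique charU UW (VB _ Vy)).
Qed.

End Realization.

(** * Exchanges with degenerate pieces *)

Section WeakExchange.
Local Open Scope ring_scope.
Context {R : realType}.
Implicit Types (s d : nat -> R) (f : R -> R).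

Definition weak_subdivision n d :=
  [/\ d 0%N = 0, d n = 1 & forall i, (i < n)%N -> d i <= d i.+1].

Definition rigid_on f (a b c e : R) :=
  {in `]a, b[, forall t, f t = c + (t - a)} \/
  {in `]a, b[, forall t, f t = e - (t - a)}.

Definition exchanges n s d (p : 'S_n) f := forall i : 'I_n,
  s i.+1 - s i = d (p i).+1 - d (p i) /\
  rigid_on f (s i) (s i.+1) (d (p i)) (d (p i).+1).

Lemma rigid_continuous f (a b c e : R) :
  rigid_on f a b c e -> {in `]a, b[, continuous f}.
Proof.
move=> rf t tab.
suff [g gc fg] : exists2 g : R -> R, continuous g & {in `]a, b[, f =1 g}.
  have near_fg : \forall u \near t, g u = f u.
    near=> u; rewrite fg //; near: u; exact: near_in_itvoo.
  rewrite /continuous_at fg //; exact: cvg_trans (near_eq_cvg near_fg) (gc t).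
case: rf => rf.
  exists (fun t => c + (t - a)) => // u.
  by apply: cvgD; [exact: cvg_cst|apply: cvgB; [exact: cvg_id|exact: cvg_cst]].
exists (fun t => e - (t - a)) => // u.
by apply: cvgB; [exact: cvg_cst|apply: cvgB; [exact: cvg_id|exact: cvg_cst]].
Unshelve. all: by end_near. Qed.

Lemma rigid_bij f (a b c e : R) : b - a = e - c ->
  rigid_on f a b c e -> set_bij `]a, b[%classic `]c, e[%classic f.
Proof.
move=> len [] rf; split.
- by move=> t /= tab; rewrite rf //; move: tab; rewrite !in_itv /=; lra.
- by move=> t u; rewrite !inE /= => tab uab; rewrite !rf //; lra.
- move=> u /=; rewrite in_itv /= => uce.
  have tab : u - c + a \in `]a, b[ by rewrite in_itv /=; lra.
  by exists (u - c + a) => //; rewrite rf //; lra.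
- by move=> t /= tab; rewrite rf //; move: tab; rewrite !in_itv /=; lra.
- by move=> t u; rewrite !inE /= => tab uab; rewrite !rf //; lra.
- move=> u /=; rewrite in_itv /= => uce.
  have tab : e - u + a \in `]a, b[ by rewrite in_itv /=; lra.
  by exists (e - u + a) => //; rewrite rf //; lra.
Qed.

Lemma strict_exchange_iet n s d (p : 'S_n) f :
  subdivision n s -> subdivision n d -> exchanges s d p f ->
  set_fun `[0, 1]%classic `[0, 1]%classic f ->
  exists2 T : pct R, is_iet T & pct_map T = f.
Proof.
move=> ss sd ex stab.
exists (PCT ss sd stab (fun i => rigid_continuous (ex i).2)
                       (fun i => rigid_bij (ex i).1 (ex i).2)) => // i /=.
have [len rf] := ex i; exists (d (p i) - s i).
by case: rf => rf; [left|right] => t /rf ->; lra.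
Qed.

Lemma perm_lift n (p : 'S_n.+1) (i : 'I_n.+1) :
  exists q : 'S_n, forall j, p (lift i j) = lift (p i) (q j).
Proof.
have /fin_all_exists[g Hg] (j : 'I_n) : exists k, p (lift i j) = lift (p i) k.
  have [|k ->] := @unlift_some _ (p i) (p (lift i j)); last by exists k.
  by rewrite (inj_eq perm_inj) neq_lift.
have inj_g : injective g.
  by move=> j k E; apply: (@lift_inj _ i); apply: (@perm_inj _ p); rewrite !Hg E.
by exists (perm inj_g) => j; rewrite Hg permE.
Qed.

(** Deleting one of two equal consecutive division points does not change the
    remaining gaps. *)
Lemma skip_endpoint d i j : d i = d i.+1 -> d (bump i j.+1) = d (bump i j).+1.
Proof.
move=> E; rewrite /bump; case: (ltngtP i j) => [ij|ji|<-].
- by rewrite leqW // ltnW.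
- rewrite leq_eqVlt ltnS leqNgt ji orbF; case: eqP => [ij|_ //].
  by move: E; rewrite ij /= !add0n => ->.
- by rewrite leqnSn.
Qed.

(** A piece of length zero has an image of length zero.  It is removed together
    with this image, without changing the map [f]; the induction ends with
    strict subdivisions. *)
Lemma weak_exchange_iet n s d (p : 'S_n) f :
  weak_subdivision n s -> weak_subdivision n d -> exchanges s d p f ->
  set_fun `[0, 1]%classic `[0, 1]%classic f ->
  exists2 T : pct R, is_iet T & pct_map T = f.
Proof.
elim: n s d p => [|n IH] s d p ws wd ex stab.
  by case: ws => -> /eqP; rewrite eq_sym oner_eq0.
have [[i E]|/forallNP pos] := pselect (exists i : 'I_n.+1, s i = s i.+1); last first.
  case: (ws) (wd) => s0 sn sle [d0 dn dle].
  apply: (@strict_exchange_iet _ s d p) => //; split => // i ltin.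
    rewrite lt_neqAle sle // andbT; apply/eqP.
    exact: (pos (Ordinal ltin)).
  rewrite lt_neqAle dle // andbT; apply/eqP => Ed.
  apply: (pos ((p^-1)%g (Ordinal ltin))); have [] := ex ((p^-1)%g (Ordinal ltin)).
  by rewrite permKV /= Ed subrr => /eqP; rewrite subr_eq0 => /eqP.
have [q Hq] := perm_lift p i.
have Ed : d (p i) = d (p i).+1.
  by have [] := ex i; rewrite E subrr => /esym/eqP; rewrite subr_eq0 => /eqP.
have weak e (k : 'I_n.+1) : weak_subdivision n.+1 e -> e k = e k.+1 ->
    weak_subdivision n (e \o bump k).
  move=> [e0 en ele] Ek; split => /=.
  - rewrite -e0 /bump leqn0; case: eqP => // k0.
    by move: Ek; rewrite k0 => <-.
  - by rewrite /bump -ltnS ltn_ord.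
  - move=> j ltjn; rewrite skip_endpoint //; apply: ele.
    by rewrite /bump; apply: leq_ltn_trans (leq_add (leq_b1 _) (leqnn j)) _.
apply: (IH (s \o bump i) (d \o bump (p i)) q) => //; try exact: weak.
move=> j /=; have [] := ex (lift i j).
by rewrite Hq /= !skip_endpoint.
Qed.

End WeakExchange.

(** * Cells with a common code *)

Section Separation.
Local Open Scope ring_scope.
Context {R : realType} {A : finType}.
Implicit Types (T : pct R) (U : A -> set R) (D : seq R) (c e t : R).

Definition separates D c e :=
  exists2 t, t \in D & (c <= t <= e) || (e <= t <= c).

Lemma separates_sub D D' c e :
  {subset D <= D'} -> separates D c e -> separates D' c e.
Proof. by move=> DD' [t /DD' tD cte]; exists t. Qed.

Lemma monotone_piece T (i : 'I_(pieces T)) :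
  {in `]src T i, src T i.+1[ &, {homo T : t u / t < u}} \/
  {in `]src T i, src T i.+1[ &, {homo T : t u /~ t < u}}.
Proof.
apply: itv_continuous_inj_mono.
  by apply: continuous_in_subspaceT => t; rewrite inE => /pct_continuous.
have [_ inj _] := pct_bij i.
by move=> t u tI uI; apply: inj; rewrite inE.
Qed.

Definition bound_seq (b : itv_bound R) : seq R :=
  if b is BSide _ t then [:: t] else [::].

Definition itv_ends (J : interval R) : seq R :=
  let: Interval b1 b2 := J in bound_seq b1 ++ bound_seq b2.

Lemma itv_not_separated (J : interval R) c e : c \in J ->
  ~ separates (itv_ends J) c e ->
  e \in J.
Proof.
case: J => b1 b2; rewrite !itv_boundlr => /andP[b1c cb2] nsep.
apply/andP; split.
  case: b1 b1c nsep => [b t|//] b1c nsep.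
  rewrite leNgt; apply/negP => et; apply: nsep; exists t; first by rewrite inE eqxx.
  apply/orP; right; apply/andP; split.
    by case: b et {b1c}; rewrite !bnd_simp // => /ltW.
  by case: b b1c {et}; rewrite !bnd_simp // => /ltW.
case: b2 cb2 nsep => [b t|//] cb2 nsep.
rewrite leNgt; apply/negP => et; apply: nsep; exists t.
  by rewrite mem_cat inE eqxx orbT.
apply/orP; left; apply/andP; split.
  by case: b cb2 {et}; rewrite !bnd_simp // => /ltW.
by case: b et {cb2}; rewrite !bnd_simp // => /ltW.
Qed.

Lemma characteristic_set_ends U : characteristic_sets U ->
  exists D, forall c e a, ~ separates D c e -> U a c -> U a e.
Proof.
move=> [_ _ fin]; have /choice[s Hs] := fin.
pose ends a := flatten [seq itv_ends J | J <- s a].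
exists (flatten [seq ends a | a <- enum A]) => c e a nsep.
have [_ ->] := Hs a; move=> [J /= Js cJ]; exists J => //=.
apply: itv_not_separated cJ _ => sep; apply: nsep.
apply: separates_sub sep => t tJ.
apply/flatten_mapP; exists a; first exact: mem_enum.
by apply/flatten_mapP; exists J.
Qed.

Lemma same_piece T c e : c \in `[0, 1] -> e \in `[0, 1] ->
  ~ separates [seq src T i | i <- iota 0 (pieces T).+1] c e ->
  exists i : 'I_(pieces T), 
    (c \in `]src T i, src T i.+1[) && (e \in `]src T i, src T i.+1[).
Proof.
move=> c01 e01 nsep.
have mem_src i : (i <= pieces T)%N ->
  src T i \in [seq src T i | i <- iota 0 (pieces T).+1].
  by move=> ile; apply/map_f; rewrite mem_iota.
have [|i ci] := subdivision_gap (src_subdivision T) c01.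
  move=> i ile E; apply: nsep; exists c; last by rewrite lexx /= andbT le_total.
  by rewrite E mem_src.
exists i; rewrite ci /=; move: ci; rewrite !in_itv /= => /andP[ic ci].
rewrite !ltNge; apply/andP; split; apply/negP => H; apply: nsep.
  by exists (src T i); [exact/mem_src/ltnW | rewrite H (ltW ic) orbT].
by exists (src T i.+1); [exact/mem_src | rewrite H (ltW ci)].
Qed.

Lemma piece_separates T (i : 'I_(pieces T)) c e t :
  c \in `]src T i, src T i.+1[ -> e \in `]src T i, src T i.+1[ ->
  t \in `]src T i, src T i.+1[ ->
  (T c <= T t <= T e) || (T e <= T t <= T c) ->
  (c <= t <= e) || (e <= t <= c).
Proof.
move=> ci ei ti; case: (monotone_piece i) => mono.
  by rewrite !(le_mono_in mono).
by rewrite !(le_nmono_in mono) // orbC ![(t <= _) && _]andbC.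
Qed.

(** By induction on [l]: cutting at the ends of the characteristic sets, at the
    division points of [T], and at the preimages in each piece of the points
    obtained for [l].  Monotonicity on the pieces ensures that a point between
    the images of two points of a piece has its preimage between them. *)
Lemma code_locally_constant T U l : characteristic_sets U -> exists D, forall c e,
  c \in `[0, 1] -> e \in `[0, 1] -> ~ separates D c e ->
  forall k, (k < l)%N -> forall a, U a (iter k T c) -> U a (iter k T e).
Proof.
move=> charU; have [D0 HD0] := characteristic_set_ends charU.
elim: l => [|l [D HD]]; first by exists [::].
pose preim i t := xget 0 [set c | T c = t /\ c \in `]src T i, src T i.+1[].
exists (D0 ++ [seq src T i | i <- iota 0 (pieces T).+1] ++
        [seq preim i t | i <- iota 0 (pieces T), t <- D]) => c e c01 e01 nsep.
case=> [_ a /=|k].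
  apply: HD0 => sep; apply: nsep; apply: separates_sub sep => t.
  by rewrite mem_cat => ->.
rewrite ltnS => ltkl a; rewrite !iterSr; apply: HD => //; try exact: pct_stable.
have [|i /andP[ci ei]] := @same_piece T _ _ c01 e01.
  move=> sep; apply: nsep; apply: separates_sub sep => t.
  by rewrite !mem_cat => ->; rewrite orbT.
move=> [t tD sep]; apply: nsep.
have [stab _ surj] := pct_bij i.
have [u ui uE] : (T @` `]src T i, src T i.+1[) t.
  (* The image of a piece is an interval, so it contains [t]. *)
  apply: surj; have := stab _ ci; have := stab _ ei; rewrite /= !in_itv /=.
  by case/orP: sep => /andP[]; lra.
have : [set c | T c = t /\ c \in `]src T i, src T i.+1[] u by [].
move=> /(xgetI 0) [vE vi]; exists (preim i t).
  rewrite !mem_cat; apply/orP; right; apply/orP; right.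
  by apply/allpairsP; exists (i : nat, t); rewrite mem_iota /=.
by apply: (piece_separates ci ei) => //; rewrite vE.
Qed.

End Separation.

(** * Invariant means along finite orbits *)

Section OrbitMean.
Local Open Scope ring_scope.
Context {R : realType}.
Implicit Types (f g : R -> R) (u v : nat -> R) (F : set_system nat).

Definition bounded_map f := exists B, forall t, `|f t| <= B.

(** The orbit segment that starts at [y N] consists of the times [0..N].  The
    comparison [mean_le] may ignore the last [K] of them, for a fixed [K]: this
    is what lets properties of the first [N + 1] letters of the code of [y N]
    pass to the mean. *)
Record orbit_mean (T : R -> R) (y : nat -> R) (M : (R -> R) -> R) : Prop :=
  OrbitMean {
    mean_add : forall f g, bounded_map f -> bounded_map g ->
      M (f \+ g) = M f + M g;
    mean_le : forall K f g, bounded_map f -> bounded_map g ->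
      (forall N k, (k + K <= N)%N -> f (iter k T (y N)) <= g (iter k T (y N))) ->
      M f <= M g;
    mean_shift : forall f, bounded_map f -> M (f \o T) = M f;
    mean_one : M (cst 1) = 1 }.

Lemma bounded_ultra_cvg F u B : UltraFilter F ->
  (forall n, `|u n| <= B) -> cvg (u @ F).
Proof.
move=> UF uB.
have ultra_u : UltraFilter (u @ F).
  split=> [|G PG FG]; first exact: fmap_proper_filter.
  apply/seteqP; split => // S GS.
  have [//|FS] := in_ultra_setVsetC (u @^-1` S) UF.
  have : G (S `&` ~` S) by apply: filterI => //; apply: FG.
  by rewrite setICr => /filter_not_empty.
have := @segment_compact R (- B) B; rewrite compact_ultra => /(_ _ ultra_u) [].
  by apply: (@filterE _ F) => n /=; rewrite in_itv /= -ler_norml.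
by move=> l [_ ul]; apply/cvg_ex; exists l.
Qed.

Lemma ultra_lim_le F u v C : UltraFilter F -> \oo `<=` F ->
  cvg (u @ F) -> cvg (v @ F) -> (forall n, u n <= v n + C * harmonic n) ->
  lim (u @ F) <= lim (v @ F).
Proof.
move=> UF ooF cu cv uv.
have vC : (fun n => v n + C * harmonic n) @ F --> lim (v @ F).
  rewrite -[X in _ --> X]addr0; apply: cvgD => //.
  rewrite -(mulr0 C); apply: cvgM; first exact: cvg_cst.
  apply: cvg_trans (@cvg_harmonic R); exact: cvg_app.
apply: ler_cvg_to cu vC _; exact: filterE.
Qed.

Definition orbit_average (T : R -> R) (y : nat -> R) f N : R :=
  harmonic N * \sum_(k < N.+1) f (iter k T (y N)).

(** The [K] last terms of the sum, on which nothing is known, contribute at most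
    [K * B]. *)
Lemma orbit_average_le T y f g K B N : 0 <= B ->
  (forall t, f t <= g t + B) ->
  (forall k, (k + K <= N)%N -> f (iter k T (y N)) <= g (iter k T (y N))) ->
  orbit_average T y f N <= orbit_average T y g N + K%:R * B * harmonic N.
Proof.
move=> B0 fgB fg; rewrite /orbit_average [_ * harmonic N]mulrC -mulrDr.
rewrite ler_wpM2l ?harmonic_ge0 //.
apply: (@le_trans _ _ (\sum_(k < N.+1)
    (g (iter k T (y N)) + (if (N < k + K)%N then B else 0)))).
  apply: ler_sum => k _; case: ltnP => [_|/fg]; first exact: fgB.
  by rewrite addr0.
rewrite big_split /= lerD2l.
rewrite -(big_mkord xpredT (fun k => if (N < k + K)%N then B else 0)).
rewrite (@big_cat_nat _ _ _ (N.+1 - K)) ?leq_subr //=.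
rewrite big_nat big1 => [|k /andP[_ ltk]]; last by case: ltnP => // Nk; exfalso; lia.
rewrite add0r.
apply: (@le_trans _ _ (\sum_(N.+1 - K <= k < N.+1) B)).
  by apply: ler_sum => k _; case: ifP.
by rewrite sumr_const_nat -(mulr_natl B) ler_wpM2r // ler_nat; lia.
Qed.

Lemma orbit_average_bounded T y f B : (forall t, `|f t| <= B) ->
  forall N, `|orbit_average T y f N| <= B.
Proof.
move=> fB N; rewrite normrM ger0_norm ?harmonic_ge0 //.
rewrite -[leRHS](mulKf (x := N.+1%:R)) // ler_wpM2l ?harmonic_ge0 //.
apply: le_trans (ler_norm_sum _ _ _) _.
apply: (@le_trans _ _ (\sum_(k < N.+1) B)); first exact: ler_sum.
by rewrite sumr_const card_ord mulr_natl.
Qed.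

Lemma orbit_average_shift T y f B N : (forall t, `|f t| <= B) ->
  `|orbit_average T y (f \o T) N - orbit_average T y f N| <= (B + B) * harmonic N.
Proof.
move=> fB; rewrite /orbit_average -mulrBr normrM ger0_norm ?harmonic_ge0 //.
rewrite mulrC ler_wpM2r ?harmonic_ge0 //.
have -> : \sum_(k < N.+1) (f \o T) (iter k T (y N)) -
    \sum_(k < N.+1) f (iter k T (y N)) = f (iter N.+1 T (y N)) - f (y N).
  rewrite big_ord_recr [in X in _ - X]big_ord_recl /=.
  under [X in _ - (_ + X)]eq_bigr do rewrite add0n.
  by ring.
exact: le_trans (ler_normB _ _) (lerD (fB _) (fB _)).
Qed.

(** An ultrafilter finer than the neighbourhoods of infinity makes all the
    bounded sequences converge at once, additively.  The terms neglected in
    each property are of the order of [1 / (N + 1)]. *)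
Lemma orbit_mean_exists T y : exists M, orbit_mean T y M.
Proof.
have [F [UF ooF]] := ultraFilterLemma eventually_filter.
exists (fun f => lim (orbit_average T y f @ F)).
have cvgA f : bounded_map f -> cvg (orbit_average T y f @ F).
  move=> [B fB]; exact: bounded_ultra_cvg (orbit_average_bounded T y fB).
split.
- move=> f g bf bg; rewrite -limD; [|exact: cvgA..].
  congr (lim (_ @ F)); apply/funext => N.
  by rewrite /orbit_average /= big_split mulrDr.
- move=> K f g bf bg fg.
  have [[Bf fB] [Bg gB]] := (bf, bg).
  apply: (@ultra_lim_le F _ _ (K%:R * (Bf + Bg))) => //; [exact: cvgA..|] => N.
  apply: orbit_average_le => [|t|k]; last exact: fg.
    by apply: addr_ge0; [apply: le_trans (fB 0)|apply: le_trans (gB 0)].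
  have := fB t; have := gB t; rewrite !ler_norml; lra.
- move=> f [B fB].
  have bfT : bounded_map (f \o T) by exists B => t; exact: fB.
  have bf : bounded_map f by exists B.
  apply/eqP; rewrite eq_le; apply/andP; split.
    apply: (@ultra_lim_le F _ _ (B + B)) => //; [exact: cvgA..|] => N.
    by have := orbit_average_shift T y N fB; rewrite ler_norml; lra.
  apply: (@ultra_lim_le F _ _ (B + B)) => //; [exact: cvgA..|] => N.
  by have := orbit_average_shift T y N fB; rewrite ler_norml; lra.
- rewrite (_ : orbit_average T y (cst 1) = cst 1); first exact: lim_cst.
  apply/funext => N; rewrite /orbit_average sumr_const card_ord.
  by rewrite mulVf.
Qed.

End OrbitMean.

(** * The invariant density *)

Section Density.
Local Open Scope ring_scope.
Context {R : realType} (T : R -> R) (y : nat -> R) (M : (R -> R) -> R).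
Hypothesis meanM : orbit_mean T y M.
Hypothesis orbit01 : forall N k, iter k T (y N) \in `[0, 1].
Implicit Types (f g : R -> R) (S : set R) (D : seq R) (t : R).

Lemma bounded_cst (a : R) : bounded_map (cst a).
Proof. by exists `|a|. Qed.

Lemma bounded_indic S : bounded_map (\1_S : R -> R).
Proof.
by exists 1 => t; rewrite indicE ger0_norm ?ler0n //; case: (_ \in _); rewrite ?ler01.
Qed.

Lemma bounded_add f g : bounded_map f -> bounded_map g -> bounded_map (f \+ g).
Proof.
move=> [B fB] [C gC]; exists (B + C) => t.
exact: le_trans (ler_normD _ _) (lerD (fB t) (gC t)).
Qed.

Lemma bounded_comp f g : bounded_map f -> bounded_map (f \o g).
Proof. by move=> [B fB]; exists B => t; exact: fB. Qed.

Lemma mean_zero : M (cst 0) = 0.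
Proof.
have := mean_add meanM (bounded_cst 0) (bounded_cst 0).
rewrite (_ : cst 0 \+ cst 0 = cst 0) => [|]; first by lra.
by apply/funext => t /=; rewrite addr0.
Qed.

Lemma bounded_orbit_sum f n : bounded_map f ->
  bounded_map (fun t => \sum_(j < n) f (iter j T t)).
Proof.
move=> bf; elim: n => [|n IH].
  by exists 0 => t; rewrite big_ord0 normr0.
have [B HB] := bounded_add IH (bounded_comp (iter n T) bf).
by exists B => t; rewrite big_ord_recr; exact: HB.
Qed.

Lemma mean_iter f n : bounded_map f -> M (f \o iter n T) = M f.
Proof.
move=> bf; elim: n => [|n IH]; first by congr M.
rewrite -IH -[RHS](mean_shift meanM (bounded_comp _ bf)); congr M.
by apply/funext => t /=; rewrite -iterSr.
Qed.

Lemma mean_orbit_sum f n : bounded_map f ->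
  M (fun t => \sum_(j < n) f (iter j T t)) = n%:R * M f.
Proof.
move=> bf; elim: n => [|n IH].
  rewrite mul0r -[RHS]mean_zero; congr M.
  by apply/funext => t; rewrite big_ord0.
rewrite -natr1 mulrDl mul1r -IH -[X in _ + X](mean_iter n bf).
rewrite -(mean_add meanM); last 2 first.
- exact: bounded_orbit_sum.
- exact: bounded_comp.
by congr M; apply/funext => t; rewrite big_ord_recr.
Qed.

Definition density S : R := M \1_S.

Lemma density_le_orbit K S S' :
  (forall N k, (k + K <= N)%N -> S (iter k T (y N)) -> S' (iter k T (y N))) ->
  density S <= density S'.
Proof.
move=> sub; apply: (mean_le meanM (K := K)); try exact: bounded_indic.
move=> N k /sub {}sub; rewrite !indicE ler_nat.
by case: (boolP (_ \in S)) => //; rewrite inE => /sub/mem_set ->.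
Qed.

Lemma density_le S S' : (forall t, t \in `[0, 1] -> S t -> S' t) ->
  density S <= density S'.
Proof. by move=> sub; apply: (density_le_orbit (K := 0)) => N k _; exact: sub. Qed.

Lemma density_ge0 S : 0 <= density S.
Proof.
rewrite -mean_zero; apply: (mean_le meanM (K := 0)).
- exact: bounded_cst.
- exact: bounded_indic.
- by move=> N k _; rewrite indicE ler0n.
Qed.

Lemma density_setU S S' : density (S `|` S') <= density S + density S'.
Proof.
rewrite -(mean_add meanM); try exact: bounded_indic.
apply: (mean_le meanM (K := 0)); try exact: bounded_indic.
  by apply: bounded_add; exact: bounded_indic.
move=> N k _ /=; rewrite !indicE in_setU.
by case: (_ \in S); case: (_ \in S') => /=; lra.
Qed.

Lemma density_disjoint S S' : [disjoint S & S'] ->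
  density (S `|` S') = density S + density S'.
Proof.
move=> /disj_setPS disj; rewrite -(mean_add meanM); try exact: bounded_indic.
congr M; apply/funext => t; rewrite /= !indicE in_setU.
have [tS|_] := boolP (t \in S); last by rewrite /= add0r.
have [tS'|_] := boolP (t \in S'); last by rewrite /= addr0.
by have [] := disj t; split; exact: set_mem.
Qed.

Lemma density_preimage S : density (T @^-1` S) = density S.
Proof. exact: (mean_shift meanM (bounded_indic S)). Qed.

Lemma density_preimage_iter k S : density (iter k T @^-1` S) = density S.
Proof. exact: (mean_iter k (bounded_indic S)). Qed.

Lemma density_full S : (forall t, t \in `[0, 1] -> S t) -> density S = 1.
Proof.
move=> full; apply/eqP; rewrite eq_le -(mean_one meanM); apply/andP; split.
  apply: (mean_le meanM (K := 0)).
  - exact: bounded_indic.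
  - exact: bounded_cst.
  - by move=> N k _; rewrite indicE lern1 leq_b1.
apply: (mean_le meanM (K := 0)).
- exact: bounded_cst.
- exact: bounded_indic.
- by move=> N k _; rewrite indicE mem_set //; exact: full.
Qed.

(** The preimages of [S] under the first [G] iterates of [T] all have the same
    density, and no point of an orbit segment lies in two of them, except near
    the end of the segment. *)
Lemma density_sparse G K S :
  (forall N k j, (0 < j < G)%N -> (k + j + K <= N)%N ->
     S (iter k T (y N)) -> ~ S (iter (k + j) T (y N))) ->
  G%:R * density S <= 1.
Proof.
move=> sparse; rewrite -mean_orbit_sum; last exact: bounded_indic.
rewrite -(mean_one meanM); apply: (mean_le meanM (K := (G + K)%N)).
- by apply: bounded_orbit_sum; exact: bounded_indic.
- exact: bounded_cst.
move=> N k kN /=.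
have indicK j : S (iter j T (iter k T (y N))) \/
    \1_S (iter j T (iter k T (y N))) = 0 :> R.
  by rewrite indicE; case: (boolP (_ \in _)); [rewrite inE; left|right].
have [[j Sj]|none] := pselect (exists j : 'I_G, S (iter j T (iter k T (y N)))).
  rewrite (bigD1 j) //= indicE mem_set // big1 ?addr0 // => i neij.
  have [Si|//] := indicK i; exfalso; move: Si Sj; rewrite -!iterD.
  rewrite ![(_ + k)%N]addnC; case: (ltngtP i j) => [ij|ji|E].
  - move=> Si; have := sparse N (k + i)%N (j - i)%N.
    rewrite (_ : k + i + (j - i) = k + j)%N; last by lia.
    by apply => //; have := ltn_ord j; lia.
  - move=> /[swap] Sj; have := sparse N (k + j)%N (i - j)%N.
    rewrite (_ : k + j + (i - j) = k + i)%N; last by lia.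
    by apply => //; have := ltn_ord i; lia.
  - by move: neij; rewrite -val_eqE /= E eqxx.
rewrite big1 // => i _; have [Si|//] := indicK i.
by case: none; exists i.
Qed.

(** The preimages of [S] under the first [n] iterates of [T] all have the same
    density, and cover the orbit segments except near their ends. *)
Lemma density_recurrent n K S :
  (forall N k, (k + K <= N)%N -> exists2 j, (j < n)%N & S (iter (k + j) T (y N))) ->
  1 <= n%:R * density S.
Proof.
move=> rec; rewrite -mean_orbit_sum; last exact: bounded_indic.
rewrite -(mean_one meanM); apply: (mean_le meanM (K := K)).
- exact: bounded_cst.
- by apply: bounded_orbit_sum; exact: bounded_indic.
move=> N k /rec[j ltjn]; rewrite addnC iterD => Sj.
rewrite (bigD1 (Ordinal ltjn)) //= indicE mem_set // lerDl.
by apply: sumr_ge0 => i _; rewrite indicE ler0n.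
Qed.

Hypothesis density1 : forall t, density [set t] = 0.

Lemma density_seq D : density [set` D] = 0.
Proof.
apply/eqP; rewrite eq_le density_ge0 andbT; elim: D => [|t D IH].
  by rewrite -mean_zero -(indic0 R); apply: density_le.
apply: (@le_trans _ _ (density ([set t] `|` [set` D]))).
  apply: density_le => s _ /=; rewrite inE.
  by move=> /predU1P[->|]; [left|right].
by apply: le_trans (density_setU _ _) _; rewrite density1 add0r.
Qed.

Lemma density_le_off D S S' :
  (forall t, t \in `[0, 1] -> t \notin D -> S t -> S' t) ->
  density S <= density S'.
Proof.
move=> sub; rewrite -[leRHS]addr0 -(density_seq D).
apply: le_trans (density_setU _ _); apply: density_le => t t01 St /=.
by have [tD|/sub tD] := boolP (t \in D); [right|left; exact: tD].
Qed.

Lemma density_eq_off D S S' :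
  (forall t, t \in `[0, 1] -> t \notin D -> S t <-> S' t) ->
  density S = density S'.
Proof.
move=> E; apply/eqP; rewrite eq_le; apply/andP.
by split; apply: (density_le_off (D := D)) => t t01 tD /E; apply.
Qed.

(** The distribution function of the density. *)
Definition cumul q : R := density [set t | t < q].

Lemma cumul_le q q' : q <= q' -> cumul q <= cumul q'.
Proof. by move=> qq'; apply: density_le => t _ /= /lt_le_trans; exact. Qed.

Lemma cumul0 : cumul 0 = 0.
Proof.
rewrite -[RHS](density_seq [::]); apply: (density_eq_off (D := [::])) => t.
by rewrite in_itv /= leNgt => /andP[/negP t0 _] _; split => [/t0|].
Qed.

Lemma cumul1 : cumul 1 = 1.
Proof.
rewrite -[RHS](@density_full setT) //; apply: (density_eq_off (D := [:: 1])) => t.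
rewrite in_itv inE /= => /andP[_ t1] tN1; split => // _.
by rewrite lt_neqAle tN1.
Qed.

Lemma cumul_itv a b : a <= b -> density [set t | a < t < b] = cumul b - cumul a.
Proof.
move=> ab; suff -> : cumul b = cumul a + density [set t | a < t < b] by ring.
rewrite -density_disjoint; last first.
  by apply/disj_setPS => t /= [ta /andP[]]; rewrite ltNge (ltW ta).
apply: (density_eq_off (D := [:: a])) => t _; rewrite inE => tNa /=; split.
  move=> tb; have [ta|at_] := ltP t a; [by left|right].
  by rewrite tb andbT lt_neqAle eq_sym tNa.
by case=> [ta|/andP[_ //]]; exact: lt_le_trans ta ab.
Qed.

End Density.

(** * Finite sets of cuts, subdivisions *)

Section FiniteObstructions.
Local Open Scope ring_scope.
Context {R : realType}.
Implicit Types (D : seq R) (q t : R).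

Lemma near_nearer_than D q :
  \forall t \near q, forall d, d \in D -> d != q -> `|t - q| < `|d - q|.
Proof.
elim: D => [|d D IH]; first by apply: filterE => t e; rewrite in_nil.
have near_d : \forall t \near q, d != q -> `|t - q| < `|d - q|.
  have [->|dq] := eqVneq d q; first by apply: filterE.
  have dq0 : 0 < `|d - q| by rewrite normr_gt0 subr_eq0.
  apply: filterS (nbhsx_ballx q _ dq0) => t.
  by rewrite -ball_normE /ball_ /= distrC.
apply: filterS2 near_d IH => t td tD e; rewrite inE => /predU1P[->//|eD].
exact: tD.
Qed.

Lemma near_not_separated D q : q \notin D ->
  \forall t \near q, ~ separates D q t.
Proof.
move=> qD; apply: filterS (near_nearer_than D q) => t near_t [d dD btw].
have dq : d != q by apply: contraNneq qD => <-.
have := near_t d dD dq; case: (ltgtP d q) dq => // dq _.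
  rewrite [`|d - q|]ltr0_norm ?subr_lt0 // ltr_norml => /andP[? ?].
  case/orP: btw => /andP[]; lra.
rewrite [`|d - q|]gtr0_norm ?subr_gt0 // ltr_norml => /andP[? ?].
case/orP: btw => /andP[]; lra.
Qed.

Lemma small_increments_continuous (phi : R -> R) :
  {homo phi : q t / q <= t} ->
  (forall eps, 0 < eps -> exists D, forall c e, c < e ->
     (forall d, d \in D -> ~~ (c < d < e)) -> phi e - phi c <= eps) ->
  continuous phi.
Proof.
move=> phi_le small q; apply/cvgrPdist_le => eps eps0.
have [D HD] := small eps eps0.
apply: filterS (near_nearer_than D q) => t near_t.
have free d : d \in D -> ~~ (q < d < t) && ~~ (t < d < q).
  move=> dD; have [->|dq] := eqVneq d q; first by rewrite !ltxx !andbF.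
  have := near_t d dD dq; case: (ltgtP d q) dq => // dq _.
    rewrite [`|d - q|]ltr0_norm ?subr_lt0 // ltr_norml; lra.
  rewrite [`|d - q|]gtr0_norm ?subr_gt0 // ltr_norml; lra.
have [qt|tq|->] := ltgtP q t; last by rewrite subrr normr0 ltW.
- rewrite distrC ger0_norm ?subr_ge0 ?phi_le ?(ltW qt) //.
  by apply: HD => // d /free/andP[].
- rewrite ger0_norm ?subr_ge0 ?phi_le ?(ltW tq) //.
  by apply: HD => // d /free/andP[].
Qed.

(** Convexity in [R] is all that has to be checked: the hull of a convex set is
    an interval with the same points. *)
Lemma finite_union_convex (I : eqType) (s : seq I) (C : I -> set R) :
  (forall i, is_interval (C i)) ->
  (forall i j, i \in s -> j \in s -> C i `&` C j !=set0 -> i = j) ->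
  finite_union_of_intervals [set t | exists2 i, i \in s & C i t].
Proof.
move=> convC disj.
have CK i : [set` Rhull (C i)] = C i by apply: RhullK; rewrite inE.
exists [seq Rhull (C i) | i <- s]; split.
  move=> _ _ /mapP[i si ->] /mapP[j sj ->]; rewrite !CK => Cij.
  by rewrite (disj i j).
apply/seteqP; split=> [t [i si Cit]|t [_ /mapP[i si ->]]].
  by exists (Rhull (C i)); [exact: map_f|rewrite CK].
by rewrite CK; exists i.
Qed.

Lemma subdivision_le n (d : nat -> R) i j : subdivision n d ->
  (i <= j <= n)%N -> d i <= d j.
Proof.
move=> [_ _ dlt] /andP[]; elim: j => [|j IH]; first by rewrite leqn0 => /eqP ->.
rewrite leq_eqVlt ltnS => /predU1P[-> //|ij] jn.
exact: le_trans (IH ij (ltnW jn)) (ltW (dlt _ jn)).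
Qed.

Lemma subdivision_gap_unique n (d : nat -> R) (i j : 'I_n) t : subdivision n d ->
  d i < t < d i.+1 -> d j < t < d j.+1 -> i = j.
Proof.
move=> sd; wlog ij : i j / (i <= j)%N.
  move=> H ti tj; have [/H|/ltnW/H E] := leqP i j; first exact.
  by rewrite E.
move=> /andP[_ ti] /andP[tj _]; apply/val_inj/eqP.
move: ij; rewrite leq_eqVlt => /orP[//|ij] /=.
have := @subdivision_le _ _ i.+1 j sd; rewrite ij ltnW ?ltn_ord // => /(_ isT).
by move=> /(lt_le_trans ti)/(lt_trans tj); rewrite ltxx.
Qed.

End FiniteObstructions.

(** * Continuity of the distribution function *)

Section AperiodicDensity.
Local Open Scope ring_scope.
Context {R : realType} {A : finType}.
Context (T : pct R) (U : A -> set R) (W : nat -> A) (y : nat -> R).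
Context (M : (R -> R) -> R).
Hypothesis charU : characteristic_sets U.
Hypothesis ur : uniformly_recurrent W.
Hypothesis aper : forall p, (0 < p)%N -> exists k, W (k + p)%N <> W k.
Hypothesis y01 : forall N, y N \in `[0, 1].
Hypothesis codeW : forall N k, (k <= N)%N -> U (W k) (iter k T (y N)).
Hypothesis meanM : orbit_mean T y M.

Let orbit01 N k : iter k T (y N) \in `[0, 1].
Proof. exact: iter_stable. Qed.

(** Two visits of the orbit of [y N] to [S] exhibit two occurrences in [W] of a
    same factor of length [l]; for [l] large enough they are at least
    [G > 1 / eps] steps apart, so that [S] is sparse. *)
Lemma density_cell eps : 0 < eps -> exists l, forall S : set R,
  (forall c e, c \in `[0, 1] -> e \in `[0, 1] -> S c -> S e ->
     forall k, (k < l)%N -> forall a, U a (iter k T c) -> U a (iter k T e)) ->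
  density M S <= eps.
Proof.
move=> eps0; set G := (Num.truncn eps^-1).+1.
have [l Hl] := repetitions_far_apart ur aper G.
exists l => S cell.
have GS : G%:R * density M S <= 1.
  apply: (density_sparse meanM (K := l)) => N k j jG kjl Sk Skj.
  apply: (Hl k j jG) => i il.
  apply: (code_unique charU (t := iter (k + j + i) T (y N))); last first.
    by apply: codeW; lia.
  rewrite (addnC (k + j)%N) iterD; apply: (cell _ _ _ _ Sk Skj _ il) => //.
  by rewrite -iterD (addnC i); apply: codeW; lia.
have epsG : 1 <= G%:R * eps.
  by rewrite -ler_pdivrMr // mul1r ltW // real_truncnS_gt ?num_real.
have G0 : 0 < G%:R :> R by rewrite ltr0n.
by rewrite -(ler_pM2l G0) (le_trans GS).
Qed.

Lemma density_point t : density M [set t] = 0.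
Proof.
apply/eqP; rewrite eq_le (density_ge0 meanM) andbT.
apply/ler_addgt0Pl => eps /density_cell[l]; rewrite addr0; apply.
by move=> c e _ _ -> ->.
Qed.

(** Finite additivity alone would let mass accumulate on one side of a point;
    but a short one-sided neighbourhood of a point lies in one cell, and the
    density of the cells is small. *)
Lemma cumul_continuous : continuous (cumul M).
Proof.
apply: small_increments_continuous.
  by move=> q q'; exact: (cumul_le meanM orbit01).
move=> eps /density_cell[l small]; have [D HD] := code_locally_constant T l charU.
exists D => c e ce free; rewrite -(cumul_itv meanM orbit01 density_point (ltW ce)).
apply: small => u v u01 v01 /= cu cv; apply: HD => // -[d dD duv].
have /negP := free d dD; apply; move: cu cv duv.
by case/andP => ? ? /andP[? ?] /orP[] /andP[]; lra.
Qed.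

End AperiodicDensity.

(** * Straightening the transformation *)

Section Conjugacy.
Local Open Scope ring_scope.
Context {R : realType} (T : pct R) (y : nat -> R) (M : (R -> R) -> R).
Hypothesis meanM : orbit_mean T y M.
Hypothesis orbit01 : forall N k, iter k T (y N) \in `[0, 1].
Hypothesis density1 : forall t, density M [set t] = 0.
Hypothesis cumul_cont : continuous (cumul M).

Local Notation phi := (cumul M).

Let phi_le : {homo phi : q t / q <= t}.
Proof. by move=> q t; exact: (cumul_le meanM orbit01). Qed.

Lemma phi_lt_cancel c e : phi c < phi e -> c < e.
Proof. by apply: contraTT; rewrite -!leNgt; exact: phi_le. Qed.

Lemma phi01 c : c \in `[0, 1] -> phi c \in `[0, 1].
Proof.
rewrite !in_itv /= => /andP[c0 c1].
rewrite -{1}(cumul0 meanM orbit01 density1) -{1}(cumul1 meanM orbit01 density1).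
by rewrite !phi_le.
Qed.

(** Up to the division points, the preimage of the open interval
    from [p] to [q] under [T] is the one from [a] to [b], because the images of the pieces are disjoint. *)
Lemma cumul_transport (i : 'I_(pieces T)) a b p q :
  src T i <= a -> b <= src T i.+1 -> a <= b ->
  dst T (shuffle T i) <= p -> q <= dst T (shuffle T i).+1 -> p <= q ->
  (forall t, t \in `]src T i, src T i.+1[ -> p < T t < q = (a < t < b)) ->
  phi q - phi p = phi b - phi a.
Proof.
move=> ia bi ab ip qi pq Tab.
rewrite -!(cumul_itv meanM orbit01 density1) // -(density_preimage meanM).
apply: (density_eq_off meanM orbit01 density1
  (D := [seq src T j | j <- iota 0 (pieces T).+1])) => t t01 tN /=.
have [j jle Ej|j tj] := subdivision_gap (src_subdivision T) t01.
  by move/negP: tN; apply; rewrite Ej map_f // mem_iota.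
split=> [/andP[pTt Ttq]|tab]; last first.
  rewrite Tab // in_itv /=; case/andP: tab => [at_ tb].
  by rewrite (le_lt_trans ia at_) (lt_le_trans tb bi).
suff Eij : i = j by rewrite -Tab ?pTt // Eij.
have [Tstab _ _] := pct_bij j.
apply: (@perm_inj _ (shuffle T)).
apply: (subdivision_gap_unique (t := T t) (dst_subdivision T)).
  by rewrite (le_lt_trans ip pTt) (lt_le_trans Ttq qi).
by have := Tstab _ tj; rewrite /= in_itv.
Qed.

Lemma piece_image (i : 'I_(pieces T)) t : t \in `]src T i, src T i.+1[ ->
  dst T (shuffle T i) < T t < dst T (shuffle T i).+1.
Proof. by have [stab _ _] := pct_bij i => /stab; rewrite /= in_itv. Qed.

Lemma cumul_piece_length (i : 'I_(pieces T)) :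
  phi (src T i.+1) - phi (src T i) =
  phi (dst T (shuffle T i).+1) - phi (dst T (shuffle T i)).
Proof.
have [_ _ slt] := src_subdivision T; have [_ _ dlt] := dst_subdivision T.
apply/esym/(cumul_transport (i := i)) => //; try exact/ltW/slt; try exact/ltW/dlt.
by move=> t ti; rewrite (piece_image ti); move: ti; rewrite in_itv /= => ->.
Qed.

Lemma cumul_piece (i : 'I_(pieces T)) :
  {in `]src T i, src T i.+1[, forall c,
     phi (T c) = phi (dst T (shuffle T i)) + (phi c - phi (src T i))} \/
  {in `]src T i, src T i.+1[, forall c,
     phi (T c) = phi (dst T (shuffle T i).+1) - (phi c - phi (src T i))}.
Proof.
case: (monotone_piece i) => mono; [left|right] => c ci;
  have /andP[dT Td] := piece_image ci; have := ci; rewrite in_itv /= => /andP[ic ic'].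
- rewrite -(@cumul_transport i (src T i) c (dst T (shuffle T i)) (T c))
    ?lexx ?(ltW ic) ?(ltW ic') ?(ltW dT) ?(ltW Td) //.
    by rewrite addrC subrK.
  move=> t ti; have /andP[-> _] := piece_image ti; have := ti.
  by rewrite in_itv /= => /andP[-> _] /=; rewrite (leW_mono_in (le_mono_in mono)).
- rewrite -(@cumul_transport i (src T i) c (T c) (dst T (shuffle T i).+1))
    ?lexx ?(ltW ic) ?(ltW ic') ?(ltW dT) ?(ltW Td) //.
    by rewrite opprB addrC subrK.
  move=> t ti; have /andP[_ ->] := piece_image ti; have := ti.
  by rewrite in_itv /= => /andP[-> _] /=; rewrite andbT (leW_nmono_in (le_nmono_in mono)).
Qed.

Lemma cumul_section : exists g : R -> R,
  forall t, t \in `[0, 1] -> g t \in `[0, 1] /\ phi (g t) = t.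
Proof.
suff /choice[g Hg] : forall t, exists c, t \in `[0, 1] -> c \in `[0, 1] /\ phi c = t.
  by exists g.
move=> t; have [t01|/negP tN] := boolP (t \in `[0, 1]); last by exists 0.
have [|||c c01 E] := @IVT _ phi 0 1 t.
- exact: ler01.
- exact: continuous_subspaceT.
- rewrite (cumul0 meanM orbit01 density1) (cumul1 meanM orbit01 density1).
  by rewrite min_l ?max_r ?ler01 //; move: t01; rewrite in_itv.
- by exists c.
Qed.

(** A level set lies between a point where [phi] is at least [q - eps / 2] and a
    point where it is at most [q + eps / 2]. *)
Lemma level_null q : density M [set t | phi t = q] = 0.
Proof.
apply/eqP; rewrite eq_le (density_ge0 meanM) andbT.
apply/ler_addgt0Pl => eps eps0; rewrite addr0.
have [[s [s01 sq]]|none] := pselect (exists s, s \in `[0, 1] /\ phi s = q); last first.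
  apply: le_trans (ltW eps0); rewrite -(density_seq meanM orbit01 density1 [::]).
  by apply: (density_le meanM orbit01) => t t01 /= tq; case: none; exists t.
have := phi01 s01; rewrite sq in_itv /= => /andP[q0 q1].
have [g Hg] := cumul_section.
have [a [a_le phia]] : exists a, (forall t, t \in `[0, 1] -> phi t = q -> a <= t) /\
    q - eps / 2 <= phi a.
  have [q0'|q0'] := leP 0 (q - eps / 2).
    have [|_ E] := Hg (q - eps / 2); first by rewrite in_itv /=; lra.
    exists (g (q - eps / 2)); rewrite E; split=> // t _ tq.
    by apply/ltW/phi_lt_cancel; rewrite E tq; lra.
  exists 0; rewrite (cumul0 meanM orbit01 density1) ltW //; split=> // t.
  by rewrite in_itv => /andP[].
have [b [b_ge phib]] : exists b, (forall t, t \in `[0, 1] -> phi t = q -> t <= b) /\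
    phi b <= q + eps / 2.
  have [q1'|q1'] := leP (q + eps / 2) 1.
    have [|_ E] := Hg (q + eps / 2); first by rewrite in_itv /=; lra.
    exists (g (q + eps / 2)); rewrite E; split=> // t _ tq.
    by apply/ltW/phi_lt_cancel; rewrite E tq; lra.
  exists 1; rewrite (cumul1 meanM orbit01 density1) ltW //; split=> // t.
  by rewrite in_itv => /andP[].
have ab : a <= b := le_trans (a_le s s01 sq) (b_ge s s01 sq).
apply: (@le_trans _ _ (density M [set t | a < t < b])); last first.
  by rewrite (cumul_itv meanM orbit01 density1) //; lra.
apply: (density_le_off meanM orbit01 density1 (D := [:: a; b])) => t t01.
rewrite !inE negb_or => /andP[ta tb] /= tq.
by rewrite !lt_neqAle eq_sym ta tb a_le ?b_ge.
Qed.

Lemma level_seq_null (D : seq R) : density M [set t | phi t \in D] = 0.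
Proof.
apply/eqP; rewrite eq_le (density_ge0 meanM) andbT; elim: D => [|q D IH].
  by rewrite -(density_seq meanM orbit01 density1 [::]); apply: (density_le meanM orbit01).
apply: (@le_trans _ _ (density M ([set t | phi t = q] `|` [set t | phi t \in D]))).
  apply: (density_le meanM orbit01) => t _ /=; rewrite inE.
  by move=> /predU1P[->|]; [left|right].
by apply: le_trans (density_setU meanM _ _) _; rewrite level_null add0r.
Qed.

Lemma orbit_levels_null (D : seq R) n :
  density M [set c | exists2 k, (k < n)%N & phi (iter k T c) \in D] = 0.
Proof.
apply/eqP; rewrite eq_le (density_ge0 meanM) andbT; elim: n => [|n IH].
  rewrite -(density_seq meanM orbit01 density1 [::]).
  by apply: (density_le meanM orbit01) => t _ [].
pose B := iter n T @^-1` [set t | phi t \in D].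
apply: (@le_trans _ _ (density M
  ([set c | exists2 k, (k < n)%N & phi (iter k T c) \in D] `|` B))).
  apply: (density_le meanM orbit01) => t _ [k].
  by rewrite ltnS leq_eqVlt => /predU1P[->|kn] Hk; [right|left; exists k].
apply: le_trans (density_setU meanM _ _) _.
by rewrite (density_preimage_iter meanM) level_seq_null addr0.
Qed.

Section Model.
Context (g : R -> R).
Hypothesis gP : forall t, t \in `[0, 1] -> g t \in `[0, 1] /\ phi (g t) = t.

(** Defining the exchange through a section [g] of [phi] avoids any choice of
    values at the division points, and makes stability of [[0, 1]]
    automatic. *)
Definition model t := phi (T (g t)).

Lemma model_stable : set_fun `[0, 1]%classic `[0, 1]%classic model.
Proof.
by move=> t /= /gP[gt01 _]; apply: phi01; exact: (@pct_stable _ T _ gt01).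
Qed.

Lemma section_piece (i : 'I_(pieces T)) t :
  t \in `]phi (src T i), phi (src T i.+1)[ -> t \in `[0, 1] ->
  g t \in `]src T i, src T i.+1[.
Proof.
rewrite !in_itv /= => /andP[it ti] t01; have [_ E] := gP t01.
by apply/andP; split; apply: phi_lt_cancel; rewrite E.
Qed.

Lemma image_piece01 (i : 'I_(pieces T)) t :
  t \in `]phi (src T i), phi (src T i.+1)[ -> t \in `[0, 1].
Proof.
rewrite !in_itv /= => /andP[it ti].
rewrite (le_trans (density_ge0 meanM _) (ltW it)) /= (le_trans (ltW ti)) //.
rewrite -[leRHS](density_full meanM orbit01 (S := setT)) //.
exact: (density_le meanM orbit01).
Qed.

Lemma model_exchanges :
  exchanges (phi \o src T) (phi \o dst T) (shuffle T) model.
Proof.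
move=> i /=; split; first exact: cumul_piece_length.
have in_piece t : t \in `]phi (src T i), phi (src T i.+1)[ ->
    phi (g t) = t /\ g t \in `]src T i, src T i.+1[.
  by move=> ti; have t01 := image_piece01 ti; split; [case: (gP t01)|exact: section_piece].
by case: (cumul_piece i) => H; [left|right] => t /in_piece[E gi];
  rewrite /model H // E.
Qed.

Lemma weak_cumul n d : subdivision n d -> weak_subdivision n (phi \o d).
Proof.
move=> [d0 dn dlt]; split => /=.
- by rewrite d0 (cumul0 meanM orbit01 density1).
- by rewrite dn (cumul1 meanM orbit01 density1).
- by move=> i ltin; apply/phi_le/ltW/dlt.
Qed.

Lemma model_iet : exists2 T' : pct R, is_iet T' & pct_map T' = model.
Proof.
apply: weak_exchange_iet model_exchanges model_stable; apply: weak_cumul.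
  exact: src_subdivision.
exact: dst_subdivision.
Qed.

(** [c] and [g (phi c)] may differ, but they lie in the same piece, where
    [phi (T c)] only depends on [phi c]. *)
Lemma model_conjugacy c : c \in `[0, 1] ->
  phi c \notin [seq phi (src T i) | i <- iota 0 (pieces T).+1] ->
  model (phi c) = phi (T c).
Proof.
move=> c01 cN.
have ends j : (j <= pieces T)%N -> phi c <> phi (src T j).
  move=> jle E; move/negP: cN; apply; rewrite E.
  by apply: (map_f (fun i => phi (src T i))); rewrite mem_iota.
have [j /ends jle Ej|i ci] := subdivision_gap (src_subdivision T) c01.
  by rewrite Ej in jle.
have : phi c \in `]phi (src T i), phi (src T i.+1)[.
  move: (ci); rewrite !in_itv /= => /andP[/ltW/phi_le ic /ltW/phi_le ic'].
  rewrite !lt_neqAle ic ic' !andbT; apply/andP; split; apply/eqP.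
    by apply/nesym/ends/ltnW.
  exact: ends.
move=> /section_piece/(_ (phi01 c01)) gi; have [_ E] := gP (phi01 c01).
by rewrite /model; case: (cumul_piece i) => H; rewrite !H // E.
Qed.

Context {A : finType} (U : A -> set R).
Hypothesis charU : characteristic_sets U.

Definition model_sets a := [set t | t \in `[0, 1] /\ U a (g t)].

Lemma section_le t u : t \in `[0, 1] -> u \in `[0, 1] -> t <= u -> g t <= g u.
Proof.
move=> t01 u01 tu; rewrite leNgt; apply/negP => gut.
have [[_ Et] [_ Eu]] := (gP t01, gP u01).
have /eqP E : t == u by rewrite eq_le tu -{1}Et -{1}Eu phi_le // ltW.
by move: gut; rewrite E ltxx.
Qed.

Lemma model_sets_characteristic : characteristic_sets model_sets.
Proof.
have [cov triv fin] := charU; split.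
- apply/seteqP; split=> [t [a _ []] //|t /= t01].
  have [gt01 _] := gP t01.
  have : `[0, 1]%classic (g t) by [].
  by rewrite -cov => -[a _ Ua]; exists a.
- by move=> a b _ _ [t [[_ Ua] [_ Ub]]]; apply: triv => //; exists (g t).
move=> a; have [s [trivs Us]] := fin a.
pose pull (J : interval R) : set R := [set t | t \in `[0, 1] /\ g t \in J].
have -> : model_sets a = [set t | exists2 J, J \in s & pull J t].
  apply/seteqP; split=> [t [t01]|t [J Js [t01 gJ]]].
    by rewrite Us => -[J /= Js gJ]; exists J.
  by split=> //; rewrite Us; exists J.
apply: finite_union_convex => [J|J K Js Ks [t [[_ tJ] [_ tK]]]]; last first.
  by apply: trivs => //; exists (g t).
move=> t u [t01 gt] [u01 gu] v /andP[tv vu].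
have v01 : v \in `[0, 1] by move: t01 u01; rewrite !in_itv /=; lra.
split => //; apply: (interval_is_interval gt gu).
by rewrite !section_le.
Qed.

(** A point of [D] between [c] and [g (phi c)] would have the same image as
    [c] under [phi]. *)
Lemma model_sets_coding D c a : (forall c e a, ~ separates D c e -> U a c -> U a e) ->
  c \in `[0, 1] -> phi c \notin [seq phi d | d <- D] -> U a c ->
  model_sets a (phi c).
Proof.
move=> HD c01 cN Uc; split; first exact: phi01.
have [_ E] := gP (phi01 c01); apply: HD Uc => -[d dD btw].
move/negP: cN; apply; apply/mapP; exists d => //.
apply/eqP; rewrite eq_le; move: btw.
by case/orP => /andP[/phi_le h1 /phi_le h2]; move: h1 h2; rewrite E => -> ->.
Qed.

End Model.
End Conjugacy.

(** * Aperiodic words *)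

Section Aperiodic.
Local Open Scope ring_scope.
Context {R : realType} {A : finType}.
Implicit Types (T : pct R) (W : nat -> A) (U : A -> set R).

(** For the prefix of length [n], a point [c] of [E] has the right evolution
    under [T]; outside [B], its orbit up to time [n] is mapped by [phi] away
    from the images of the division points and of the ends of the
    characteristic sets, and its image is not in [D].  So [phi c] has the same
    evolution in the exchange, and so do its neighbours. *)
Lemma aperiodic_iet T W : uniformly_recurrent W ->
  (forall p, (0 < p)%N -> exists k, W (k + p)%N <> W k) ->
  generated_by T W -> exists T' : pct R, is_iet T' /\ generated_by T' W.
Proof.
move=> ur aper /generated_realizes[U charU real].
have /choice[y Hy] : forall N, exists t : R, t \in `[0, 1] /\
    forall k, (k <= N)%N -> U (W k) (iter k T t).
  move=> N; have [V [_ [t Vt] HV]] := real N.+1; exists t; split; first by case: Vt.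
  by have /finite_evolution_mkseq := HV _ Vt.
have y01 N : y N \in `[0, 1] by case: (Hy N).
have codeW N k : (k <= N)%N -> U (W k) (iter k T (y N)) by case: (Hy N) => _; apply.
have [M meanM] := orbit_mean_exists T y.
have orbit01 N k : iter k T (y N) \in `[0, 1] by exact: iter_stable.
have density1 := density_point charU ur aper y01 codeW meanM.
have cumul_cont := cumul_continuous charU ur aper y01 codeW meanM.
have [g gP] := cumul_section meanM orbit01 density1 cumul_cont.
have [T' ietT' ET'] := model_iet meanM orbit01 density1 gP.
have charU' := model_sets_characteristic meanM orbit01 gP charU.
exists T'; split => //; apply: (realizes_generated charU') => n.
have [D0 HD0] := characteristic_set_ends charU.
have [D HD] := code_locally_constant T' n charU'.
pose E := [set c | forall k, (k < n)%N -> U (W k) (iter k T c)].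
pose Q := [seq cumul M (src T i) | i <- iota 0 (pieces T).+1] ++
          [seq cumul M d | d <- D0] ++ D.
pose B := [set c | exists2 k, (k < n.+1)%N & cumul M (iter k T c) \in Q].
have E_pos : 0 < density M E.
  have [N HN] := uniformly_recurrentP ur 0 n.
  have : 1 <= N.+1%:R * density M E.
    apply: (density_recurrent meanM (K := N)) => m k kNm.
    have [j jnN Wj] := HN k; exists j; first by lia.
    move=> i ltin; rewrite -iterD addnC -(add0n i) -Wj // -addnA.
    by apply: codeW; lia.
  rewrite lt_neqAle (density_ge0 meanM) andbT; apply: contraTneq => <-.
  by rewrite mulr0 ler10.
have [c [c01 Ec Bc]] : exists c, [/\ c \in `[0, 1], E c & ~ B c].
  apply: contrapT => none.
  have B0 := orbit_levels_null meanM orbit01 density1 cumul_cont Q n.+1.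
  have : density M E <= density M B.
    apply: (density_le meanM orbit01) => t t01 Et.
    by apply: contrapT => NBt; apply: none; exists t.
  by rewrite B0 leNgt E_pos.
have avoid k : (k <= n)%N -> cumul M (iter k T c) \notin Q.
  by move=> kn; apply/negP => kQ; apply: Bc; exists k.
have c01k k : iter k T c \in `[0, 1] by exact: iter_stable.
have track k : (k <= n)%N -> iter k T' (cumul M c) = cumul M (iter k T c).
  elim: k => // k IH kn; rewrite iterS IH ?(ltnW kn) // ET'.
  apply: (model_conjugacy meanM orbit01 density1 gP) => //.
  by have := avoid k (ltnW kn); rewrite mem_cat negb_or => /andP[].
have phic01 := phi01 meanM orbit01 density1 c01.
have cND : cumul M c \notin D.
  by have := avoid 0%N isT; rewrite !mem_cat !negb_or => /and3P[].
have := near_not_separated cND; rewrite -[X in X -> _]/(nbhs _ _) nbhsE.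
move=> [V [oV Vc] VD]; exists V; split=> //; first by exists (cumul M c).
move=> t [/VD ct t01]; apply/finite_evolution_mkseq => k ltkn.
apply: (HD _ _ phic01 t01 ct k ltkn).
rewrite track; last exact: ltnW.
apply: (model_sets_coding meanM orbit01 density1 gP HD0) => //; last exact: Ec.
by have := avoid k (ltnW ltkn); rewrite !mem_cat !negb_or => /and3P[].
Qed.

End Aperiodic.

(** * Periodic words *)

Section Periodic.
Local Open Scope ring_scope.
Context {R : realType} {A : finType}.
Implicit Types (W : nat -> A).

(** The rotation by [h] of the circle of length 1, for [t] in [[0, 1]]. *)
Definition rotation (h t : R) := if t < 1 - h then t + h else t + h - 1.

Lemma rotation_stable h : 0 <= h <= 1 ->
  set_fun `[0, 1]%classic `[0, 1]%classic (rotation h).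
Proof.
by move=> h01 t /=; rewrite !in_itv /= /rotation; case: ltP; lra.
Qed.

Lemma rotation_iet h : 0 <= h <= 1 ->
  exists2 T : pct R, is_iet T & pct_map T = rotation h.
Proof.
move=> h01.
(* The two pieces are exchanged; for [h = 1] the first one is degenerate. *)
pose cut (a : R) (i : nat) := if i is i'.+1 then (if i' is 0%N then a else 1) else 0.
have weak a : 0 <= a <= 1 -> weak_subdivision 2 (cut a).
  by move=> a01; split=> // -[|[|]] //= _; case/andP: a01.
apply: (@weak_exchange_iet _ 2 (cut (1 - h)) (cut h) (tperm ord0 ord_max)).
- by apply: weak; lra.
- exact: weak.
- move=> i; case: (unliftP ord0 i) => [j ->|->].
    rewrite (ord1 j) (_ : lift _ _ = ord_max); last exact: val_inj.
    rewrite tpermR /=; split; first by ring.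
    left=> t; rewrite in_itv /= => /andP[ht _].
    by rewrite /rotation ltNge ltW //=; ring.
  rewrite tpermL /=; split; first by ring.
  left=> t; rewrite in_itv /= => /andP[_ th].
  by rewrite /rotation th; ring.
- exact: rotation_stable.
Qed.

Lemma periodic_modn W p : (forall k, W (k + p)%N = W k) ->
  forall k, W (k %% p)%N = W k.
Proof.
move=> per k; rewrite [in RHS](divn_eq k p) addnC.
by elim: (k %/ p)%N => [|q IH]; rewrite ?addn0 // mulSn addnCA addnC per.
Qed.

Lemma rotation_orbit p (t : R) k : (0 < p)%N -> 0 < t < p%:R^-1 ->
  iter k (rotation p%:R^-1) t = t + (k %% p)%N%:R * p%:R^-1.
Proof.
move=> p0 /andP[t0 tp]; have ph : p%:R * p%:R^-1 = 1 :> R.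
  by rewrite mulfV // pnatr_eq0 -lt0n.
set h := p%:R^-1 in tp ph *; have h0 : 0 < h := lt_trans t0 tp.
elim: k => [|k IH]; first by rewrite mod0n mul0r addr0.
have := modnS k p; rewrite iterS IH /rotation.
have := ltn_pmod k p0; set r := (k %% p)%N => rp.
have [dvd|_] := boolP (p %| k.+1)%N => Er.
  have rE : r.+1 = p.
    apply/eqP; rewrite eqn_leq rp dvdn_leq // /dvdn -addn1 modnDml addn1.
    exact/eqP.
  have : r.+1%:R * h = 1 by rewrite rE.
  by rewrite Er mul0r -natr1 mulrDl mul1r; case: ltP; lra.
have : r.+2%:R * h <= 1.
  by rewrite -[leRHS]ph ler_wpM2r ?(ltW h0) // ler_nat -Er ltn_pmod.
by rewrite Er -!natr1 !mulrDl mul1r; case: ltP; lra.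
Qed.

(** The interval is cut into [p] cells of length [1 / p], permuted cyclically,
    and the [i]-th cell is labelled by [W i].  The point 1 forms an additional
    cell, of index [p]. *)
Lemma periodic_iet W p : (0 < p)%N -> (forall k, W (k + p)%N = W k) ->
  exists T : pct R, is_iet T /\ generated_by T W.
Proof.
move=> p0 per; have p0' : 0 < p%:R :> R by rewrite ltr0n.
have h0 : 0 < p%:R^-1 :> R by rewrite invr_gt0.
have h1 : p%:R^-1 <= 1 :> R by rewrite invf_le1 // ler1n.
have h01 : 0 <= (p%:R^-1 : R) <= 1 by rewrite ltW.
have [T ietT ET] := rotation_iet h01; exists T; split => //.
pose cell (t : R) := Num.truncn (p%:R * t).
have le_cell : {homo cell : t u / t <= u >-> (t <= u)%N}.
  by move=> t u tu; apply: le_truncn; exact: ler_wpM2l tu.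
pose U a := [set t : R | t \in `[0, 1] /\ W (cell t) = a].
have charU : characteristic_sets U.
  split.
  - apply/seteqP; split=> [t [a _ []] //|t t01].
    by exists (W (cell t)).
  - by move=> a b _ _ [t [[_ <-] [_ <-]]].
  move=> a; pose C i := [set t : R | t \in `[0, 1] /\ cell t = i].
  rewrite (_ : U a = [set t | exists2 i, i \in [seq i <- iota 0 p.+1 | W i == a]
                            & C i t]); last first.
    apply/seteqP; split=> [t [t01 Wt]|t [i]]; last first.
      by rewrite mem_filter => /andP[/eqP <- _] [t01 <-].
    exists (cell t) => //; rewrite mem_filter Wt eqxx mem_iota /= add0n ltnS.
    rewrite -[leqRHS](@natrK R) -[p%:R]mulr1; apply: le_cell.
    by move: t01; rewrite in_itv => /andP[].
  apply: finite_union_convex.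
    move=> i t u [t01 ti] [u01 ui] v /andP[tv vu]; split.
      by move: t01 u01; rewrite !in_itv /=; lra.
    by apply/eqP; rewrite eqn_leq -{1}ui -ti !le_cell.
  by move=> i j _ _ [t [[_ <-] [_ <-]]].
apply: (realizes_generated charU) => n.
exists `]0, p%:R^-1[%classic; split.
- exact: interval_open.
- by exists (p%:R^-1 / 2); split; rewrite /= in_itv /=; lra.
move=> t [/= tp _]; apply/finite_evolution_mkseq => k _.
rewrite in_itv /= in tp; rewrite ET rotation_orbit //.
have := ltn_pmod k p0; set r := (k %% p)%N => rp.
have rh : r.+1%:R / p%:R <= 1 :> R by rewrite ler_pdivrMr // mul1r ler_nat.
have r0 : 0 <= r%:R / p%:R :> R by rewrite divr_ge0.
split; first by move: rh; rewrite in_itv /= -natr1 mulrDl mul1r; lra.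
rewrite -(periodic_modn per k) -/r; congr W; apply: truncn_def.
have -> : p%:R * (t + r%:R / p%:R) = p%:R * t + r%:R :> R.
  by field; rewrite pnatr_eq0 -lt0n.
have : 0 < p%:R * t < 1.
  by case/andP: tp => t0 tp; rewrite mulr_gt0 //= mulrC -ltr_pdivlMr // div1r.
by rewrite -natr1; lra.
Qed.

End Periodic.

Theorem mainTheorem7 (R : realType) (A : finType) :
  [set W : nat -> A | uniformly_recurrent W /\
     exists T : pct R, generated_by T W] =
  [set W : nat -> A | uniformly_recurrent W /\
     exists T : pct R, is_iet T /\ generated_by T W].
Proof.
apply/seteqP; split=> W [ur [T genT]]; split=> //; last by exists T; case: genT.
have [[p [p0 per]]|aper] :=
  pselect (exists p, 0 < p /\ forall k, W (k + p) = W k).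
  exact: periodic_iet p0 per.
apply: aperiodic_iet genT => // p p0.
by apply/existsNP => per; apply: aper; exists p.
Qed.
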